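(* Let $L>0$ and let $\rho\in\mathbb{R}$ with $-\frac{1}{20L}\le \rho\le 0$. Let $F:\mathbb{R}^n\to\mathbb{R}^n$ be $L$-Lipschitz, let $A:\mathbb{R}^n\rightrightarrows\mathbb{R}^n$ be maximally monotone, suppose $F+A$ is $\rho$-comonotone, and let $z^*\in\mathbb{R}^n$ satisfy $0\in F(z^* )+A(z^* )$. Let $\eta=\frac{0.31}{L}$, let $z_0\in\mathbb{R}^n$, let $\{z_k\}_{k\ge0}$ be the iterates of composite-EAG with step size $\eta$ started at $z_0$, and let $\{w_k\}_{k\ge0}$ be the iterates of OHM with the same $\eta$ and $w_0=z_0$. Let $H^2:=6\|z_1-z_0\|^2+\|z_0-z^*\|^2$. Then for every integer $k\ge1$, $$\|z_{k+1}-w_{k+1}\|^2\le\frac{40000H^2}{(k+1)^{\frac12}}+\frac{30000H^2}{(k+1)^2}.$$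
   Context: $\mathbb{R}^n$ carries the Euclidean inner product $\langle\cdot,\cdot\rangle$ and norm $\|\cdot\|$. A set-valued operator $E:\mathbb{R}^n\rightrightarrows\mathbb{R}^n$ is $\rho$-comonotone if $\langle u-u',z-z'\rangle\ge\rho\|u-u'\|^2$ for all $z,z'$ and all $u\in E(z)$, $u'\in E(z')$; it is monotone if it is $0$-comonotone, and maximally monotone if it is monotone and its graph is not strictly contained in the graph of another monotone operator. $(F+A)(z)=\{F(z)+c: c\in A(z)\}$. The resolvent of an operator $B$ with parameter $\eta>0$ is $J_{\eta B}=(I+\eta B)^{-1}$; under the stated hypotheses both $J_{\eta A}$ and $J_{\eta(F+A)}$ are single-valued and defined on all of $\mathbb{R}^n$. Put $\beta_k=\frac1{k+1}$. composite-EAG: $z_1=J_{\eta A}[z_0-\eta F(z_0)]$, $c_1=\frac{z_0-\eta F(z_0)-z_1}{\eta}$, and for $k\ge1$ $$z_{k+\frac12}=\beta_kz_0+(1-\beta_k)z_k-\eta F(z_k)-\eta c_k,$$ $$z_{k+1}=J_{\eta A}[\beta_kz_0+(1-\beta_k)z_k-\eta F(z_{k+\frac12})],$$ $$c_{k+1}=\frac{\beta_kz_0+(1-\beta_k)z_k-\eta F(z_{k+\frac12})-z_{k+1}}{\eta}.$$ OHM (optimized Halpern's method): for $k\ge0$, $w_{k+\frac12}=\beta_kw_0+(1-\beta_k)w_k$ and $w_{k+1}=J_{\eta(F+A)}[w_{k+\frac12}]$. *)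

(* Defs.v *)
From mathcomp Require Import all_boot all_order all_algebra.
From mathcomp Require Import classical_sets reals.

Set Implicit Arguments.
Unset Strict Implicit.
Unset Printing Implicit Defensive.

Import Order.TTheory GRing.Theory Num.Theory.
Local Open Scope classical_set_scope.
Local Open Scope ring_scope.

Section Euclidean.
Context {R : realType} {n : nat}.
Implicit Types u v : 'rV[R]_n.

Definition dotr u v : R := \sum_(i < n) u 0 i * v 0 i.

(* Not the norm `|u| that MathComp-Analysis puts on matrices, which is the
   maximum norm. *)
Definition norm2 u : R := Num.sqrt (dotr u u).

Definition lipschitz2 (L : R) (F : 'rV[R]_n -> 'rV[R]_n) : Prop :=
  forall u v, norm2 (F u - F v) <= L * norm2 (u - v).

End Euclidean.

Section Operators.
Context {R : realType} {n : nat}.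
Local Notation V := 'rV[R]_n.

Definition operator := V -> set V.

Definition op_graph (E : operator) : set (V * V) := [set p | E p.1 p.2].

Definition op_inv (E : operator) : operator := fun x => [set z | E z x].

Definition op_scale (a : R) (E : operator) : operator :=
  fun z => [set a *: c | c in E z].

Definition op_add (F : V -> V) (A : operator) : operator :=
  fun z => [set F z + c | c in A z].

Definition comonotone (rho : R) (E : operator) : Prop :=
  forall z z' u u' : V, E z u -> E z' u' ->
    dotr (u - u') (z - z') >= rho * norm2 (u - u') ^+ 2.

Definition monotone (E : operator) : Prop := comonotone 0 E.

Definition maximally_monotone (E : operator) : Prop :=
  monotone E /\
  forall B : operator, monotone B -> ~ (op_graph E `<` op_graph B).

(* The set-valued inverse of I + eta B.  Where it is single-valued,
   z = J_(eta B)[x] reads resolvent eta B x z. *)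
Definition resolvent (eta : R) (B : operator) : operator :=
  op_inv (op_add idfun (op_scale eta B)).

End Operators.

Section Algorithms.
Context {R : realType} {n : nat}.
Local Notation V := 'rV[R]_n.

Definition beta (k : nat) : R := (k.+1%:R)^-1.

(* zh k stands for z_(k + 1/2); zh 0 and c 0 are not part of the algorithm and
   are left unconstrained. *)
Definition composite_EAG (F : V -> V) (A : operator) (eta : R) (z0 : V)
    (z zh c : nat -> V) : Prop :=
  [/\ z 0%N = z0,
      resolvent eta A (z0 - eta *: F z0) (z 1%N),
      c 1%N = eta^-1 *: (z0 - eta *: F z0 - z 1%N)
    & forall k : nat, (1 <= k)%N ->
      [/\ zh k = beta k *: z0 + (1 - beta k) *: z k
                   - eta *: F (z k) - eta *: c k,
          resolvent eta A
            (beta k *: z0 + (1 - beta k) *: z k - eta *: F (zh k)) (z k.+1)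
        & c k.+1 = eta^-1 *: (beta k *: z0 + (1 - beta k) *: z k
                                - eta *: F (zh k) - z k.+1)]].

(* wh k stands for w_(k + 1/2). *)
Definition OHM (F : V -> V) (A : operator) (eta : R) (w0 : V)
    (w wh : nat -> V) : Prop :=
  w 0%N = w0 /\
  forall k : nat,
    wh k = beta k *: w0 + (1 - beta k) *: w k /\
    resolvent eta (op_add F A) (wh k) (w k.+1).

End Algorithms.

Arguments operator : clear implicits.

(* Main.v *)
Require Import Defs.
From mathcomp Require Import all_boot all_order all_algebra.
From mathcomp Require Import classical_sets reals.
From mathcomp Require Import ring lra.

Import Order.TTheory GRing.Theory Num.Theory.
Local Open Scope classical_set_scope.
Local Open Scope ring_scope.

(** Everything is rescaled by [eta]: the operator becomes
[B = eta (F + A)], which is [p]-comonotone for [p = rho / eta >= - 5 / 31],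
and [eta F] is Lipschitz with constant [31 / 100].  Put
[G_k = eta (F z_k + c_k)], an element of [B z_k], and
[e_k = eta (F z_(k+1) - F z_(k+1/2))], with [z_0] in the role of [z_(1/2)].
Eliminating [c_(k+1)] from the algorithm gives

  [z_(k+1) + G_(k+1) = beta_k z_0 + (1 - beta_k) z_k + e_k],

so composite-EAG is the Halpern iteration of OHM perturbed by [e_k].

Stability of OHM.  Write [d_k = z_k - w_k].  Since [p >= - 1/2], the resolvent
of [B] is nonexpansive, hence [(k+1) |d_(k+1)| <= k |d_k| + (k+1) |e_k|].
Squaring with a well chosen weight turns this into
[k |d_k|^2 <= |e_0|^2 + 2 sum_(1 <= j < k) j (j+1) |e_j|^2]
([tracking_bound]).

Summability of the perturbations.  The sum is bounded by a multiple of [H^2]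
([weighted_error_bound]).  The usual potential of anchored methods,
[k (k+1) / 2 |G_k|^2 + k <G_k, z_k - z_0>], decreases along the unperturbed
iteration by comonotonicity between consecutive iterates.  Here [e_k] is
controlled by [G_(k+1) - G_k], because
[z_(k+1) - z_(k+1/2) = e_k - (G_(k+1) - G_k)], and the step size is small enough
for the decrease to absorb [k (k+1) / 2 |e_k|^2].  What remains is a term
[(k+1) <G_(k+1), e_k>], for which the potential may grow by a bounded multiple
of [|G_(k+1)|^2] ([potential_step]).  As the potential controls
[k^2 |G_k|^2 / 4] up to [|z_0 - zstar|^2] ([potential_lower_bound]), that growth
is by a relative factor [1 + O(1 / k^2)], whose product converges
([growth_bound]).

Together these give [|z_k - w_k|^2 <= 17 H^2 / k], which is stronger than the
claimed bound. *)

(** * The Euclidean inner product *)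

Section InnerProduct.
Context {R : realType} {n : nat}.
Implicit Types (u v w : 'rV[R]_n) (a t : R).

Lemma dotrC u v : dotr u v = dotr v u.
Proof. by apply: eq_bigr => i _; rewrite mulrC. Qed.

Lemma dotrDl u v w : dotr (u + v) w = dotr u w + dotr v w.
Proof. by rewrite /dotr -big_split; apply: eq_bigr => i _; rewrite mxE mulrDl. Qed.

Lemma dotrZl a u v : dotr (a *: u) v = a * dotr u v.
Proof. by rewrite /dotr mulr_sumr; apply: eq_bigr => i _; rewrite mxE mulrA. Qed.

Lemma dotrDr u v w : dotr w (u + v) = dotr w u + dotr w v.
Proof. by rewrite dotrC dotrDl !(dotrC w). Qed.

Lemma dotrZr a u v : dotr u (a *: v) = a * dotr u v.
Proof. by rewrite dotrC dotrZl dotrC. Qed.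

Lemma dotrNl u v : dotr (- u) v = - dotr u v.
Proof. by rewrite -scaleN1r dotrZl mulN1r. Qed.

Lemma dotrNr u v : dotr u (- v) = - dotr u v.
Proof. by rewrite dotrC dotrNl dotrC. Qed.

Definition dotrE := (dotrDl, dotrDr, dotrNl, dotrNr, dotrZl, dotrZr).

Lemma dotr_ge0 u : 0 <= dotr u u.
Proof. by apply: sumr_ge0 => i _; rewrite -expr2 sqr_ge0. Qed.

Lemma norm2_sqr u : norm2 u ^+ 2 = dotr u u.
Proof. by rewrite sqr_sqrtr // dotr_ge0. Qed.

(** The weighted Young inequality, in the division-free form whose only input
is that [t u - v] has nonnegative squared length. *)
Lemma dotr_young t u v : 2 * t * dotr u v <= t ^+ 2 * dotr u u + dotr v v.
Proof.
have := dotr_ge0 (t *: u - v); rewrite !dotrE (dotrC v u).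
by move=> h; lra.
Qed.

End InnerProduct.

(** * Scaling of operators *)

Section Scaling.
Context {R : realType} {n : nat}.
Local Notation V := 'rV[R]_n.

Lemma comonotone_op_scale (eta rho : R) (E : operator R n) :
  0 < eta -> comonotone rho E -> comonotone (rho / eta) (op_scale eta E).
Proof.
move=> eta0 mE z z' _ _ [u Eu <-] [u' Eu' <-].
have := ler_wpM2l (ltW eta0) (mE _ _ _ _ Eu Eu').
rewrite -scalerBr !norm2_sqr !dotrZl !dotrZr.
move: (dotr _ _) (dotr _ _) => y x h.
suff -> : rho / eta * (eta * (eta * x)) = eta * (rho * x) by [].
by field; exact: lt0r_neq0.
Qed.

Lemma lipschitz2_sqr (L eta : R) (F : V -> V) (u v : V) :
  0 <= L -> lipschitz2 L F ->
  dotr (eta *: (F u - F v)) (eta *: (F u - F v))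
    <= (eta * L) ^+ 2 * dotr (u - v) (u - v).
Proof.
move=> L0 lF; rewrite dotrZl dotrZr mulrA -expr2 exprMn -[leRHS]mulrA.
apply: ler_wpM2l; first exact: sqr_ge0.
rewrite -!norm2_sqr -exprMn; apply: lerXn2r (lF u v); rewrite nnegrE.
  exact: sqrtr_ge0.
by apply: mulr_ge0 => //; exact: sqrtr_ge0.
Qed.

Lemma resolventP (eta : R) (A : operator R n) (x z : V) :
  0 < eta -> resolvent eta A x z -> A z (eta^-1 *: (x - z)).
Proof.
move=> eta0 [_ [c Ac <-] /= <-]; rewrite addrAC subrr add0r scalerA mulVf ?scale1r//.
exact: lt0r_neq0.
Qed.

End Scaling.

(** * One step of the accelerated method *)

Section Potential.
Context {R : realType} {n : nat}.
Implicit Types (K p : R) (G a e D : 'rV[R]_n).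

Definition potential K G a : R := K * (K + 1) / 2 * dotr G G + K * dotr G a.

(** This is where the size of the step enters.  With [u = G_(k+1) - G_k],
comonotonicity yields the decrease [(p + 1/2) |u|^2], from which the
perturbation takes [<u, e>]; the Lipschitz bound makes the difference a
positive definite form with room left for [3/2 |e|^2]: one unit pays for the
cross term with [G_(k+1)] and one half is kept in order to sum the
perturbations. *)
Lemma extrapolation_slack p (u e : 'rV[R]_n) :
  - (5 / 31) <= p ->
  dotr e e <= (31 / 100) ^+ 2 * dotr (e - u) (e - u) ->
  3 / 2 * dotr e e <= (p + 1 / 2) * dotr u u - dotr u e.
Proof.
move=> hp; rewrite !dotrE (dotrC e u) => he.
have h0 := dotr_ge0 e; have h1 := dotr_ge0 u.
(* Adding about 5/2 times the Lipschitz bound leaves a form close to a multiple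
   of the squared length of u - 66/25 e. *)
have h2 := dotr_young (66 / 25) e u; rewrite (dotrC e u) in h2.
have h3 : 0 <= (p + 5 / 31) * dotr u u by apply: mulr_ge0 => //; lra.
lra.
Qed.

(** Multiplying the comonotonicity inequality by [K (K + 1)] and eliminating
[a' - a] by the recurrence makes the terms [K <G, a>] telescope.  The remainder
is [K (K + 1)] times the form of [extrapolation_slack], minus
[(K + 1) <G', e>].  The latter is not controlled by [|G' - G|], and Young's
inequality splits it between [|e|^2] and [|G'|^2]; its weight is such that the
[|G'|^2] part has a coefficient that stays bounded in [K]. *)
Lemma potential_step K p G G' a a' e :
  0 < K -> - (5 / 31) <= p ->
  (K + 1) *: a' = K *: a + (K + 1) *: (e - G') ->
  p * dotr (G' - G) (G' - G) <= dotr (G' - G) (a' - a) ->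
  dotr e e <= (31 / 100) ^+ 2 * dotr (e - (G' - G)) (e - (G' - G)) ->
  potential (K + 1) G' a' + K * (K + 1) / 2 * dotr e e
    <= potential K G a + (K + 1) / (4 * K) * dotr G' G'.
Proof.
move=> K0 hp rec com /(extrapolation_slack _ _ _ hp) slack.
have KK : 0 <= K * (K + 1) by apply: mulr_ge0; lra.
have r1 := congr1 (dotr G) rec; have r2 := congr1 (dotr G') rec.
have s1 := ler_wpM2l KK com; have s2 := ler_wpM2l KK slack.
have y : (K + 1) * dotr G' e <= K * (K + 1) * dotr e e + (K + 1) / (4 * K) * dotr G' G'.
  have := dotr_young (2 * K) e G'; rewrite (dotrC e G') => y.
  have q0 : 0 <= (K + 1) / (4 * K) by apply: divr_ge0; lra.
  have := ler_wpM2l q0 y.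
  have -> : (K + 1) / (4 * K) * (2 * (2 * K) * dotr G' e) = (K + 1) * dotr G' e.
    by field; lra.
  have -> : (K + 1) / (4 * K) * ((2 * K) ^+ 2 * dotr e e + dotr G' G') =
    K * (K + 1) * dotr e e + (K + 1) / (4 * K) * dotr G' G' by field; lra.
  by [].
have t1 := congr1 ( *%R K) r1; have t2 := congr1 ( *%R K) r2.
rewrite /potential; move: ((K + 1) / (4 * K) * _) y => Y y.
rewrite !dotrE (dotrC G' G) in r1 r2 t1 t2 s1 s2 *.
lra.
Qed.

(** Comonotonicity between [G] and the zero at [D] replaces [<G, a>] by
[<G, D>], and completing the square costs [|D|^2] and half of the quadratic
part of the potential. *)
Lemma potential_lower_bound K p G a D :
  0 <= K -> - (5 / 31) <= p ->
  p * dotr G G <= dotr G (a - D) ->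
  K ^+ 2 / 4 * dotr G G <= potential K G a + dotr D D.
Proof.
move=> K0 hp; rewrite /potential !dotrE => /(ler_wpM2l K0) h.
have h0 := dotr_young (- (K / 2)) G D.
have h1 : 0 <= K * ((p + 5 / 31) * dotr G G).
  by apply: mulr_ge0 => //; apply: mulr_ge0; [lra | exact: dotr_ge0].
have h2 : 0 <= K * dotr G G by apply: mulr_ge0 => //; exact: dotr_ge0.
lra.
Qed.

(** For [a = e - G] the potential collapses to [<G, e>], which is small because
the first step moves by [a]. *)
Lemma potential_first G a e :
  a = e - G ->
  dotr e e <= (31 / 100) ^+ 2 * dotr a a ->
  potential 1 G a <= 6 * dotr a a.
Proof.
move=> ->; rewrite /potential !dotrE (dotrC e G) => he.
have h0 := dotr_ge0 e; have h1 := dotr_ge0 G; have := dotr_ge0 (e - G).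
rewrite !dotrE (dotrC e G) => h2.
have := dotr_young 2 e G; rewrite (dotrC e G) => h3.
lra.
Qed.

End Potential.

(** * Summation along the iterates *)

(** A discrete Gronwall inequality: the relative growth at step [k] is
[1 / (k (k + 1))].  The product of the growth factors is dominated by the
telescoping sequence [4 k / (k + 2)] from [k = 2] on; the first factor, 2, is
too large for it and explains the constant 4. *)
Lemma growth_bound (R : realType) (T : nat -> R) :
  0 <= T 1%N ->
  (forall k : nat, (1 <= k)%N ->
     k%:R * (k%:R + 1) * (T k.+1 - T k) <= T k.+1) ->
  forall k : nat, (1 <= k)%N -> T k <= 4 * T 1%N.
Proof.
move=> T1 step.
have bnd k : (k.+2%:R + 2) * T k.+2 <= 4 * T 1%N * k.+2%:R.
  elim: k => [|k IHk]; first by have := step 1%N isT; lra.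
  have := step k.+2 isT; rewrite -(natr1 k.+2).
  have : 2 <= k.+2%:R :> R by rewrite ler_nat.
  move: k.+2%:R (T k.+2) (T k.+3) IHk => K t t' IH K2 st.
  have p0 : 0 < (K + 2) * (K ^+ 2 + K - 1) by apply: mulr_gt0; nra.
  rewrite -(ler_pM2l p0).
  have s1 : (K ^+ 2 + K - 1) * t' <= K * (K + 1) * t by lra.
  have m1 : 0 <= (K + 2) * (K + 3) by apply: mulr_ge0; lra.
  have m2 : 0 <= (K + 3) * (K * (K + 1)).
    by apply: mulr_ge0; [lra | apply: mulr_ge0; lra].
  have s2 := ler_wpM2l m1 s1; have s3 := ler_wpM2l m2 IH.
  have s4 : 0 <= 4 * T 1%N * (K + 1) * (K - 2).
    by apply: mulr_ge0; [apply: mulr_ge0; lra | lra].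
  lra.
case=> [//|[|k]] _; first lra.
have := bnd k; have : 0 < k.+2%:R + 2 :> R by rewrite ltr_wpDl.
move=> k0 h; rewrite -(ler_pM2l k0) (le_trans h) //.
lra.
Qed.

Section Trajectory.
Context {R : realType} {n : nat}.
Implicit Types (p : R) (G a e d g : nat -> 'rV[R]_n) (D : 'rV[R]_n).

Definition weighted_error e k : R :=
  \sum_(1 <= j < k) j%:R * (j%:R + 1) * dotr (e j) (e j).

Lemma weighted_errorS e k : (1 <= k)%N ->
  weighted_error e k.+1 =
    weighted_error e k + k%:R * (k%:R + 1) * dotr (e k) (e k).
Proof. by move=> k1; rewrite /weighted_error big_nat_recr. Qed.

(** With [T k] the initial energy plus the total growth allowed by
[potential_step], the energy inequality bounds both [k^2 |G_k|^2 / 4] and half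
of the weighted error by [T k].  The first bound makes [T] satisfy the
hypothesis of [growth_bound], since [T] grows by a multiple of [|G_(k+1)|^2];
the second one then gives the conclusion. *)
Lemma weighted_error_bound p G a e D :
  - (5 / 31) <= p ->
  a 0%N = 0 ->
  (forall k : nat,
     (k%:R + 1) *: a k.+1 = k%:R *: a k + (k%:R + 1) *: (e k - G k.+1)) ->
  (forall k : nat, (1 <= k)%N ->
     p * dotr (G k.+1 - G k) (G k.+1 - G k)
       <= dotr (G k.+1 - G k) (a k.+1 - a k)) ->
  (forall k : nat, (1 <= k)%N ->
     dotr (e k) (e k) <= (31 / 100) ^+ 2 *
       dotr (e k - (G k.+1 - G k)) (e k - (G k.+1 - G k))) ->
  (forall k : nat, (1 <= k)%N -> p * dotr (G k) (G k) <= dotr (G k) (a k - D)) ->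
  dotr (e 0%N) (e 0%N) <= (31 / 100) ^+ 2 * dotr (a 1%N) (a 1%N) ->
  forall k : nat, (1 <= k)%N ->
    weighted_error e k <= 8 * (6 * dotr (a 1%N) (a 1%N) + dotr D D).
Proof.
move=> hp a0 rec com ext mono e0.
set H := 6 * _ + _.
pose T k := H + \sum_(1 <= j < k) (j%:R + 1) / (4 * j%:R) * dotr (G j.+1) (G j.+1).
have a1 : a 1%N = e 0%N - G 1%N by have := rec 0%N; rewrite !add0r !scale1r scale0r add0r.
have TS k : (1 <= k)%N ->
    T k.+1 = T k + (k%:R + 1) / (4 * k%:R) * dotr (G k.+1) (G k.+1).
  by move=> k1; rewrite /T big_nat_recr //= addrA.
have T1 : T 1%N = H by rewrite /T big_geq // addr0.
have energy k : (1 <= k)%N ->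
    potential k%:R (G k) (a k) + dotr D D + weighted_error e k / 2 <= T k.
  elim: k => [//|[_ _|k IHk _]].
    rewrite T1 /weighted_error big_geq // /H.
    by have := potential_first _ _ _ a1 e0; lra.
  have k0 : 0 < k.+1%:R :> R by rewrite ltr0n.
  have := potential_step k.+1%:R p _ _ _ _ _ k0 hp (rec k.+1)
    (com k.+1 isT) (ext k.+1 isT).
  rewrite TS // weighted_errorS // natr1; have := IHk isT.
  by move: k.+2%:R k.+1%:R (T k.+1) => K2 K1 t; lra.
have W0 k : 0 <= weighted_error e k.
  apply: sumr_ge0 => j _; apply: mulr_ge0; last exact: dotr_ge0.
  by apply: mulr_ge0; rewrite ?addr_ge0.
have lower k : (1 <= k)%N -> k%:R ^+ 2 / 4 * dotr (G k) (G k) + weighted_error e k / 2 <= T k.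
  move=> k1; have := energy k k1.
  by have := potential_lower_bound k%:R p _ _ _ (ler0n _ k) hp (mono k k1); lra.
have growth k : (1 <= k)%N -> k%:R * (k%:R + 1) * (T k.+1 - T k) <= T k.+1.
  move=> k1; have := lower k.+1 isT; have := W0 k.+1.
  have -> : T k.+1 - T k = (k%:R + 1) / (4 * k%:R) * dotr (G k.+1) (G k.+1).
    by rewrite TS // addrAC subrr add0r.
  have k0 : k%:R != 0 :> R by rewrite pnatr_eq0 -lt0n.
  have -> : k%:R * (k%:R + 1) * ((k%:R + 1) / (4 * k%:R) * dotr (G k.+1) (G k.+1))
     = k.+1%:R ^+ 2 / 4 * dotr (G k.+1) (G k.+1) by rewrite -natr1; field.
  lra.
move=> k k1; have := lower k k1.
have H0 : 0 <= T 1%N.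
  rewrite T1 /H; have := dotr_ge0 D; have := dotr_ge0 (a 1%N); lra.
have := growth_bound _ T H0 growth k k1; rewrite T1.
have : 0 <= k%:R ^+ 2 / 4 * dotr (G k) (G k).
  by apply: mulr_ge0; [rewrite divr_ge0 ?sqr_ge0 | exact: dotr_ge0].
lra.
Qed.

(** Nonexpansiveness of the resolvent, which holds from [p >= - 1/2] on, gives
[(K + 1) |d'| <= |K d + (K + 1) e|].  Squaring with the weights [1 + 1/K] and
[K + 1] keeps the coefficient of [|d|^2] equal to [K], so that [K |d|^2]
telescopes. *)
Lemma perturbed_resolvent_step K p (d d' g e : 'rV[R]_n) :
  0 <= K -> - (1 / 2) <= p ->
  (K + 1) *: (d' + g) = K *: d + (K + 1) *: e ->
  p * dotr g g <= dotr g d' ->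
  (K + 1) * dotr d' d' <= K * dotr d d + (K + 1) ^+ 2 * dotr e e.
Proof.
move=> K0 hp rec mono.
(* Nonexpansiveness: the comonotonicity bound absorbs the cross term. *)
have contr : dotr d' d' <= dotr (d' + g) (d' + g).
  rewrite !dotrE (dotrC d' g).
  have := dotr_ge0 g; have : 0 <= (p + 1 / 2) * dotr g g.
    by apply: mulr_ge0; [lra | exact: dotr_ge0].
  lra.
have K1 : 0 < K + 1 by lra.
have sq : (K + 1) ^+ 2 * dotr (d' + g) (d' + g) =
    dotr (K *: d + (K + 1) *: e) (K *: d + (K + 1) *: e).
  by rewrite -rec dotrZl dotrZr mulrA.
rewrite -(ler_pM2l K1).
have c2 : (K + 1) ^+ 2 * dotr d' d' <= (K + 1) ^+ 2 * dotr (d' + g) (d' + g).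
  by apply: ler_wpM2l => //; exact: sqr_ge0.
have := ler_wpM2l K0 (dotr_young (K + 1) e d).
move: c2; rewrite sq !dotrE (dotrC d e).
lra.
Qed.

(** Iterating [perturbed_resolvent_step]; the factor 2 comes from
[(k + 1)^2 <= 2 k (k + 1)]. *)
Lemma tracking_bound p d g e :
  - (1 / 2) <= p ->
  (forall k : nat,
     (k%:R + 1) *: (d k.+1 + g k.+1) = k%:R *: d k + (k%:R + 1) *: e k) ->
  (forall k : nat, p * dotr (g k.+1) (g k.+1) <= dotr (g k.+1) (d k.+1)) ->
  forall k : nat, (1 <= k)%N ->
    k%:R * dotr (d k) (d k) <= dotr (e 0%N) (e 0%N) + 2 * weighted_error e k.
Proof.
move=> hp rec mono; elim=> [//|[_ _|k IHk _]].
  have := perturbed_resolvent_step 0 p _ _ _ _ (lexx 0) hp (rec 0%N) (mono 0%N).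
  by rewrite /weighted_error big_geq //; lra.
have k1 : 1 <= k.+1%:R :> R by rewrite ler1n.
have := perturbed_resolvent_step k.+1%:R p _ _ _ _ (ler0n _ _) hp (rec _) (mono _).
move: (IHk isT); rewrite [weighted_error e k.+2]weighted_errorS // -(natr1 k.+1).
have : 0 <= (k.+1%:R - 1) * (k.+1%:R + 1) * dotr (e k.+1) (e k.+1).
  by apply: mulr_ge0; [apply: mulr_ge0; lra | exact: dotr_ge0].
lra.
Qed.

End Trajectory.

(** * The two methods *)

Theorem theorem3p8 (R : realType) (n : nat) (L rho : R)
  (F : 'rV[R]_n -> 'rV[R]_n) (A : operator R n) (zstar z0 : 'rV[R]_n)
  (z zh c w wh : nat -> 'rV[R]_n) :
  0 < L ->
  - (1 / (20 * L)) <= rho -> rho <= 0 ->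
  lipschitz2 L F ->
  maximally_monotone A ->
  comonotone rho (op_add F A) ->
  op_add F A zstar 0 ->
  let eta := 31 / 100 / L in
  composite_EAG F A eta z0 z zh c ->
  OHM F A eta z0 w wh ->
  let Hsq := 6 * norm2 (z 1%N - z0) ^+ 2 + norm2 (z0 - zstar) ^+ 2 in
  forall k : nat, (1 <= k)%N ->
    norm2 (z k.+1 - w k.+1) ^+ 2 <=
      4 * 10 ^+ 4 * Hsq / Num.sqrt k.+1%:R + 3 * 10 ^+ 4 * Hsq / k.+1%:R ^+ 2.
Proof.
move=> L0 rho_ge _ lF _ coB zeroB eta [z_0 res1 c1 EAG] [w_0 HW] Hsq k k1.
have eta0 : 0 < eta by rewrite !divr_gt0.
have etaN0 : eta != 0 by exact: lt0r_neq0.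
have etaL : eta * L = 31 / 100 by rewrite /eta divfK // lt0r_neq0.
set p := rho / eta.
have p_ge : - (5 / 31) <= p.
  rewrite /p ler_pdivlMr //; apply: le_trans rho_ge.
  by rewrite /eta le_eqVlt; apply/orP; left; apply/eqP; field; exact: lt0r_neq0.
pose B := op_scale eta (op_add F A).
have coS : comonotone p B by exact: comonotone_op_scale.
pose y j := beta j *: z0 + (1 - beta j) *: z j.
(* At index 0 the anchor has weight 1 and z0 plays the role of the half-step,
   so that the first iterate obeys the general recurrence. *)
pose q j := if j is 0 then z0 else zh j.
have betaE j : (j%:R + 1) * beta j = 1 :> R.
  by rewrite /beta natr1 divff // pnatr_eq0.
have y0 : y 0%N = z0 by rewrite /y /beta invr1 subrr scale1r scale0r addr0.
have zE j : resolvent eta A (y j - eta *: F (q j)) (z j.+1) /\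
            eta *: c j.+1 = y j - eta *: F (q j) - z j.+1.
  case: j => [|j]; first by rewrite y0 c1 scalerA divff // scale1r.
  by have [_ r ->] := EAG j.+1 isT; rewrite scalerA divff // scale1r.
pose G j := eta *: (F (z j) + c j).
pose e j := eta *: (F (z j.+1) - F (q j)).
have BG j : B (z j.+1) (G j.+1).
  exists (F (z j.+1) + c j.+1) => //; exists (c j.+1) => //.
  have [r cE] := zE j.
  by have := resolventP _ _ _ _ eta0 r; rewrite -cE scalerA mulVf // scale1r.
have zS j : z j.+1 = y j + e j - G j.+1.
  have [_ cE] := zE j; rewrite /e /G scalerBr scalerDr cE.
  by apply/rowP => i; rewrite !mxE; ring.
have anchor j (t : 'rV[R]_n) :
    (j%:R + 1) *: (beta j *: z0 + (1 - beta j) *: t) = z0 + j%:R *: t.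
  rewrite scalerDr !scalerA mulrBr betaE scale1r mulr1; congr (_ + _ *: _); ring.
have zhG j : (1 <= j)%N -> q j = y j - G j.
  case: j => // j j1; rewrite /q; have [-> _ _] := EAG j.+1 j1.
  by rewrite /y /G scalerDr; apply/rowP => i; rewrite !mxE; ring.
pose a j := z j - z0.
pose D := zstar - z0.
have arec j : (j%:R + 1) *: a j.+1 = j%:R *: a j + (j%:R + 1) *: (e j - G j.+1).
  have -> : a j.+1 = y j + (e j - G j.+1) - z0 by rewrite /a zS addrA.
  rewrite scalerBr scalerDr anchor /a.
  by apply/rowP => i; rewrite !mxE; ring.
have W := weighted_error_bound p G a e D p_ge.
have {}W : weighted_error e k.+1 <= 8 * (6 * dotr (a 1%N) (a 1%N) + dotr D D).
  apply: W => // [|j j1|j j1|j j1|].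
  - by rewrite /a z_0 subrr.
  - have -> : a j.+1 - a j = z j.+1 - z j by rewrite /a opprB addrA subrK.
    by case: j j1 => // j _; have := coS _ _ _ _ (BG j.+1) (BG j); rewrite norm2_sqr.
  - have -> : e j - (G j.+1 - G j) = z j.+1 - q j.
      by rewrite zhG // zS; apply/rowP => i; rewrite !mxE; ring.
    by rewrite -etaL; exact: lipschitz2_sqr (ltW L0) lF.
  - have -> : a j - D = z j - zstar by rewrite /a /D opprB addrA subrK.
    have Bz : B zstar 0 by exists 0 => //; exact: scaler0.
    by case: j j1 => // j _; have := coS _ _ _ _ (BG j) Bz; rewrite norm2_sqr subr0.
  - by rewrite -etaL; exact: lipschitz2_sqr (ltW L0) lF.
pose d j := z j - w j.
(* g j is the element of B (w j) selected by the resolvent step to w j. *)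
pose g j := wh j.-1 - w j.
have Bg j : B (w j.+1) (g j.+1).
  have [_ r] := HW j; exists (eta^-1 *: g j.+1); last by rewrite scalerA divff // scale1r.
  exact: resolventP r.
have drec j : (j%:R + 1) *: (d j.+1 + (G j.+1 - g j.+1)) =
    j%:R *: d j + (j%:R + 1) *: e j.
  have -> : d j.+1 + (G j.+1 - g j.+1) = y j - wh j + e j.
    by rewrite /d /g zS /=; apply/rowP => i; rewrite !mxE; ring.
  have [-> _] := HW j; rewrite scalerDr scalerBr !anchor /d.
  by apply/rowP => i; rewrite !mxE; ring.
have track : k.+1%:R * dotr (d k.+1) (d k.+1)
    <= dotr (e 0%N) (e 0%N) + 2 * weighted_error e k.+1.
  apply: (tracking_bound p d (fun j => G j - g j)) => // [|j]; first lra.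
  by have := coS _ _ _ _ (BG j) (Bg j); rewrite norm2_sqr.
have e0 : dotr (e 0%N) (e 0%N) <= (31 / 100) ^+ 2 * dotr (a 1%N) (a 1%N).
  by rewrite -etaL; exact: lipschitz2_sqr (ltW L0) lF.
have HsqE : Hsq = 6 * dotr (a 1%N) (a 1%N) + dotr D D.
  by rewrite /Hsq !norm2_sqr -(opprB zstar) -/D dotrNl dotrNr opprK.
have H0 : 0 <= Hsq by rewrite /Hsq !norm2_sqr; have := dotr_ge0 (z 1%N - z0);
  have := dotr_ge0 (z0 - zstar); lra.
have main : k.+1%:R * dotr (d k.+1) (d k.+1) <= 17 * Hsq.
  have := dotr_ge0 D; have := dotr_ge0 (a 1%N); rewrite HsqE; lra.
rewrite norm2_sqr -/(d k.+1).
have K0 : 0 < k.+1%:R :> R by rewrite ltr0n.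
have s0 : 0 < Num.sqrt k.+1%:R :> R by rewrite sqrtr_gt0.
have s_le : Num.sqrt k.+1%:R <= k.+1%:R :> R.
  rewrite -[leRHS]sqr_sqrtr ?ler0n // expr2 ler_pMr //.
  by rewrite -[leLHS]sqrtr1 ler_wsqrtr // ler1n.
apply: (@le_trans _ _ (17 * Hsq / Num.sqrt k.+1%:R)).
  rewrite ler_pdivlMr // mulrC (le_trans _ main) // ler_wpM2r //.
  exact: dotr_ge0.
rewrite -[leLHS]addr0; apply: lerD.
  apply: ler_wpM2r; first by rewrite invr_ge0 ltW.
  by apply: ler_wpM2r => //; lra.
apply: divr_ge0; last exact: sqr_ge0.
by apply: mulr_ge0 => //; lra.
Qed.
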